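(* Let $d \ge 2$ be an integer, let $c \in \mathbb{R}^d_{>0}$ and $M > 0$, and let $\overline{P} = \{y \in [0,1]^d \mid \langle c, y\rangle \le M\}$. Consider the following online game over rounds $t = 1, 2, \ldots$: the algorithm plays $y_t \in \overline{P}$, which depends only on the history $\mathcal{H}^t$ of everything that happened before round $t$; an adversary then chooses a concave gain function $h_t : \mathbb{R}^d \to \mathbb{R}_{\ge 0}$, which may depend on $\mathcal{H}^t$ and on $y_t$; the algorithm then observes a random vector $H_t \in \mathbb{R}^d$ whose conditional expectation given $\mathcal{H}^t$ and $y_t$ is a subgradient $\partial h_t(y_t)$. Suppose that with probability $1$, $H_{t,i}\cdot (M/c_i) \in [0,1]$ for every round $t$ and every coordinate $i \in [d]$. Then for every $\eta \in (0,1]$ and every stopping time $\tau$ with respect to the histories $(\mathcal{H}^t)_t$, the stochastic online mirror descent algorithm (run with step size determined by $\eta$) guarantees, for all $y^\star \in \overline{P}$, $$\mathbb{E}\Big[\sum_{t \le \tau} h_t(y_t)\Big] \ \ge\ (1-\eta)\,\mathbb{E}\Big[\sum_{t \le \tau} h_t(y^\star)\Big] - \frac{O(\log d)}{\eta},$$ where the $O(\cdot)$ hides an absolute constant.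
   Context: The stochastic online mirror descent (OMD) algorithm here works in rescaled coordinates $x_i = c_i y_i / M$, in which $\overline{P}$ becomes a subset $\mathcal{V}$ of the full simplex $\{x \in [0,1]^d : \sum_i x_i \le 1\}$; it uses the unnormalized entropy regularizer $\psi(x) = \sum_i (x_i \ln x_i - x_i)$, whose Bregman divergence is the unnormalized KL divergence $\mathrm{uKL}(p;q) = \sum_i (p_i \log(p_i/q_i) - p_i + q_i)$, and it starts from $x = \frac1d \mathbf{1}$. At each round it performs the update $x_{t+1} \in \arg\min_{x \in \mathcal{V}} \langle -G_t, x\rangle + \frac{1}{\eta'}\mathrm{uKL}(x; x_t)$ with the rescaled stochastic gradient $G_t = (M H_{t,i}/c_i)_i$ and a step size $\eta'$ equal to a constant multiple of $\eta$. The expectations are over the randomness of the gradient estimates, which affect the iterates and therefore possibly the future functions $h_t$. *)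

(* Defs.v *)
From HB Require Import structures.
From mathcomp Require Import all_boot all_order all_algebra.
From mathcomp Require Import all_classical all_reals all_analysis.

Set Implicit Arguments.
Unset Strict Implicit.
Unset Printing Implicit Defensive.

Import Order.TTheory GRing.Theory Num.Theory.
Import numFieldNormedType.Exports.

Local Open Scope classical_set_scope.
Local Open Scope ring_scope.

Section vectors.
Context {R : realType} {d : nat}.
Implicit Types (c x y z p q g : 'rV[R]_d) (M step : R).

Definition dot x y : R := \sum_i x 0 i * y 0 i.

(* The feasible set written P-bar in the mathematics. *)
Definition polytope c M : set 'rV[R]_d :=
  [set y : 'rV[R]_d | (forall i, 0 <= y 0 i <= 1) /\ dot c y <= M].

Definition rescale c M y : 'rV[R]_d := \row_i (c 0 i * y 0 i / M).

Definition rescaled_polytope c M : set 'rV[R]_d :=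
  rescale c M @` polytope c M.

Definition rescaled_gradient c M g : 'rV[R]_d := \row_i (M * g 0 i / c 0 i).

(* As [ln] is total with [ln 0 = 0], the summand at [p 0 i = 0] is [q 0 i]:
   this is the convention 0 log 0 = 0. *)
Definition uKL p q : R :=
  \sum_i (p 0 i * ln (p 0 i / q 0 i) - p 0 i + q 0 i).

Definition is_argmin (A : set 'rV[R]_d) (f : 'rV[R]_d -> R) x : Prop :=
  A x /\ forall z, A z -> f x <= f z.

(* The point (1/d, ..., 1/d) may lie outside V.  As the first play has to be
   feasible, it is the Bregman projection of that point on V, which is the point
   itself when it lies in V. *)
Definition omd_iterates (V : set 'rV[R]_d) step (G x : nat -> 'rV[R]_d) : Prop :=
  is_argmin V (fun z => uKL z (const_mx d%:R^-1)) (x 1%N) /\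
  forall t, (0 < t)%N ->
    is_argmin V (fun z => dot (- G t) z + step^-1 * uKL z (x t)) (x t.+1).

Definition concave_on (A : set 'rV[R]_d) (f : 'rV[R]_d -> R) : Prop :=
  @convex_function R 'rV[R]_d A (fun z => - f z).

(* Concave functions: the affine function supporting f at y lies above f. *)
Definition is_subgradient (A : set 'rV[R]_d) (f : 'rV[R]_d -> R) y g : Prop :=
  forall z, A z -> f z <= f y + dot g (z - y).

End vectors.

Section probability.
Context {R : realType} {disp : measure_display} {T : measurableType disp}.
Implicit Types (E : set (set T)) (F : nat -> set (set T)) (P : probability T R).

(* For a sigma-algebra E, [g_sigma_algebraType E] is T with the measurable sets
   E. *)
Definition measurable_wrt E (X : T -> R) : Prop :=
  measurable_fun [set: g_sigma_algebraType E]
    (X : g_sigma_algebraType E -> R).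

Definition vector_measurable_wrt {d : nat} E (X : T -> 'rV[R]_d) : Prop :=
  forall i, measurable_wrt E (fun w => X w 0 i).

Definition is_filtration F : Prop :=
  [/\ forall t, sigma_algebra setT (F t),
      forall t, F t `<=` measurable &
      forall t, F t `<=` F t.+1].

(* Z is a version of the conditional expectation of X given E. *)
Definition is_condexp P E (X Z : T -> R) : Prop :=
  [/\ P.-integrable setT (EFin \o X), P.-integrable setT (EFin \o Z),
      measurable_wrt E Z &
      forall A, E A ->
        (\int[P]_(w in A) (Z w)%:E = \int[P]_(w in A) (X w)%:E)%E].

Definition is_vector_condexp {d : nat} P E (X Z : T -> 'rV[R]_d) : Prop :=
  forall i, is_condexp P E (fun w => X w 0 i) (fun w => Z w 0 i).

(* [None] stands for the value +oo of a stopping time. *)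
Definition before (t : nat) (tau : option nat) : bool :=
  if tau is Some n then (t <= n)%N else true.

Definition is_stopping_time F (tau : T -> option nat) : Prop :=
  forall t, F t [set w | exists2 n, tau w = Some n & (n <= t)%N].

(* Rounds are t = 1, 2, ...; F t is the history before round t, which is any
   filtration to which the plays, the gain functions and the observations are
   adapted.  F 0 only serves to speak of stopping times that take the value 0.
   Since y t is F t-measurable, conditioning on F t and y t is conditioning on
   F t; [grad t] is that conditional expectation of the observation H t.

   A concave function that is nonnegative on the whole of R^d is constant, so
   concavity, nonnegativity and the subgradient inequality are only required on
   the feasible set; they hold there if they hold on R^d. *)
Record online_game {d : nat} P (c : 'rV[R]_d) (M : R) F
    (y : nat -> T -> 'rV[R]_d) (h : nat -> T -> 'rV[R]_d -> R)
    (H grad : nat -> T -> 'rV[R]_d) : Prop := {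
  game_filtration : is_filtration F;
  play_feasible : forall t w, (0 < t)%N -> polytope c M (y t w);
  play_adapted : forall t, (0 < t)%N -> vector_measurable_wrt (F t) (y t);
  gain_concave : forall t w, (0 < t)%N -> concave_on (polytope c M) (h t w);
  gain_ge0 : forall t w z, (0 < t)%N -> polytope c M z -> 0 <= h t w z;
  gain_adapted : forall t z, (0 < t)%N -> polytope c M z ->
    measurable_wrt (F t) (fun w => h t w z);
  gain_play_adapted : forall t, (0 < t)%N ->
    measurable_wrt (F t) (fun w => h t w (y t w));
  observation_adapted : forall t, (0 < t)%N ->
    vector_measurable_wrt (F t.+1) (H t);
  observation_condexp : forall t, (0 < t)%N ->
    is_vector_condexp P (F t) (H t) (grad t);
  observation_subgradient : forall t, (0 < t)%N ->
    {ae P, forall w, is_subgradient (polytope c M) (h t w) (y t w) (grad t w)}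
}.

(* The gains accumulated over the rounds t <= tau. *)
Definition expected_gain P (tau : T -> option nat) (gain : nat -> T -> R)
    : \bar R :=
  (\int[P]_w \sum_(1 <= t <oo | before t (tau w)) (gain t w)%:E)%E.

End probability.

(* Main.v *)
(* Each update satisfies the three-point inequality of mirror descent, and the
   entropy regularizer makes the stability term of a round at most
   [eta * <G_t, x_t>] when the step is [eta / 2]; the divergences telescope, and
   the first one is at most [3 ln d].  So, for every feasible u,
     sum_(t <= tau) (<H_t, u> - (1 + eta) <H_t, y_t>) <= 6 ln d / eta
   on almost every path.  Taking expectations replaces H_t by its conditional
   expectation g_t, because y_t and [t <= tau] belong to the history.  Finally
   h_t(u) - h_t(y_t) <= <g_t, u - y_t>, and the subgradient inequality at the
   origin together with h_t(0) >= 0 turns the multiplicative error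
   [eta * <g_t, y_t>] into at most [eta * h_t(y_t)].  Dividing by 1 + eta is
   harmless, as (1 - eta)(1 + eta) <= 1. *)

Require Import Defs.
From HB Require Import structures.
From mathcomp Require Import all_boot all_order all_algebra.
From mathcomp Require Import all_classical all_reals all_analysis.
From mathcomp Require Import measurable_realfun ring lra.

Set Implicit Arguments.
Unset Strict Implicit.
Unset Printing Implicit Defensive.

Import Order.TTheory GRing.Theory Num.Theory.
Import numFieldNormedType.Exports.
Local Open Scope classical_set_scope.
Local Open Scope ring_scope.

(** * Scalar inequalities for the unnormalized divergence *)

Section kl_divergence.
Context {R : realType}.
Implicit Types a b e g p q u x z : R.

Definition kl p q : R := p * ln (p / q) - p + q.

(** Splitting the logarithm makes [kl] affine in [ln q], so that later identities reduce to linear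
    arithmetic. At p = 0 the factor p absorbs the default value of [ln]. *)
Lemma klE p q : 0 <= p -> 0 < q -> kl p q = p * ln p - p * ln q - p + q.
Proof.
rewrite /kl le_eqVlt => /predU1P[<-|p0] q0; first by rewrite !mul0r !subr0.
by rewrite ln_div ?posrE// mulrBr.
Qed.

Lemma ln_le_subr1 x : 0 < x -> ln x <= x - 1.
Proof.
move=> x0; have := @le_ln1Dx R (x - 1).
by rewrite subrKC; apply; rewrite ltrBrDr addNr.
Qed.

Lemma mulr_ln_div_le p q x : 0 <= p -> 0 < q -> 0 < x ->
  p * (ln q - ln x) <= p * (q / x - 1).
Proof.
by move=> p0 q0 x0; rewrite -ln_div ?posrE// ler_wpM2l// ln_le_subr1// divr_gt0.
Qed.

Lemma kl_ge0 p q : 0 <= p -> 0 < q -> 0 <= kl p q.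
Proof.
move=> p0 q0; rewrite klE//; have [->|pN0] := eqVneq p 0; first by lra.
have {}p0 : 0 < p by rewrite lt_neqAle eq_sym pN0.
have := mulr_ln_div_le (ltW p0) q0 p0.
rewrite !mulrBr mulrCA mulfV// mulr1; lra.
Qed.

(** Both sides are the Jensen gap (1 - e) x ln x + e u ln u - z ln z of the entropy: the terms in q
    cancel because z is the weighted mean of x and u. *)
Lemma kl_bregman e u x z q : 0 <= u -> 0 <= x -> 0 < q -> 0 < z ->
  z = (1 - e) * x + e * u ->
  (1 - e) * kl x q + e * kl u q - kl z q = (1 - e) * kl x z + e * kl u z.
Proof.
move=> u0 x0 q0 z0 zE; rewrite !klE// ?(ltW z0)//.
by move: (ln z) => lnz; rewrite zE; ring.
Qed.

(** When z = x + e (u - x), the bound is e (u - x)^2 / x, which vanishes as e tends to 0. *)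
Lemma kl_subr_le u x z : 0 <= u -> 0 < x -> 0 < z ->
  kl u x - kl u z <= (u - x) * (z - x) / x.
Proof.
move=> u0 x0 z0; rewrite !klE//; have := mulr_ln_div_le u0 z0 x0.
have -> : (u - x) * (z - x) / x = u * (z / x - 1) - z + x.
  by field; rewrite gt_eqF.
lra.
Qed.

(* Fenchel-Young inequality for [kl ^~ x], with e^a <= 1 / (1 - a). *)
Lemma kl_conjugate_le g x z : 0 <= g <= 2^-1 -> 0 < x -> 0 < z ->
  g * z - kl z x <= x * (g + 2 * g ^+ 2).
Proof.
move=> /andP[g0 g1] x0 z0.
have e1g : expR g <= 1 + g + 2 * g ^+ 2.
  have := expR_ge1Dx (- g); rewrite expRN => gV.
  have eg0 := expR_gt0 g.
  have egV : (1 - g) * expR g <= 1 by rewrite -ler_pdivlMr// div1r; lra.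
  have g_lt1 : 0 < 1 - g by lra.
  rewrite -(ler_pM2l g_lt1); apply: le_trans egV _.
  (* The bound g <= 1/2 makes the excess over 1 nonnegative. *)
  have -> : (1 - g) * (1 + g + 2 * g ^+ 2) = 1 + g ^+ 2 * (1 - 2 * g) by ring.
  by rewrite lerDl mulr_ge0 ?sqr_ge0//; lra.
(* The point x e^g maximizes g z - kl z x over z, with value x (e^g - 1). *)
have w0 : 0 < x * expR g by rewrite mulr_gt0// expR_gt0.
have := mulr_ln_div_le (ltW z0) w0 z0.
rewrite lnM ?posrE ?expR_gt0// expRK.
have -> : z * (x * expR g / z - 1) = x * expR g - z by field; rewrite gt_eqF.
rewrite klE ?(ltW z0)// => lnle.
have : x * expR g <= x * (1 + g + 2 * g ^+ 2) by rewrite ler_wpM2l// ltW.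
lra.
Qed.

End kl_divergence.

(** * Optimality and regret of one mirror descent step *)

Section mirror_step.
Context {R : realType} {d : nat}.
Implicit Types (c g p q u x y z : 'rV[R]_d) (V : set 'rV[R]_d) (a e eta M : R).

Definition segment_closed V := forall x u e, V x -> V u -> 0 < e < 1 ->
  V ((1 - e) *: x + e *: u).

Definition nonneg_set V := forall x i, V x -> 0 <= x 0 i.

Lemma uKL_sum p q : uKL p q = \sum_i kl (p 0 i) (q 0 i).
Proof. by []. Qed.

Lemma uKL_ge0 p q : (forall i, 0 <= p 0 i) -> (forall i, 0 < q 0 i) ->
  0 <= uKL p q.
Proof. by move=> p0 q0; rewrite uKL_sum sumr_ge0// => i _; exact: kl_ge0. Qed.

Lemma uKL_bregman e u x z q : (forall i, 0 <= u 0 i) -> (forall i, 0 <= x 0 i) ->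
  (forall i, 0 < q 0 i) -> (forall i, 0 < z 0 i) -> z = (1 - e) *: x + e *: u ->
  (1 - e) * uKL x q + e * uKL u q - uKL z q = (1 - e) * uKL x z + e * uKL u z.
Proof.
move=> u0 x0 q0 z0 zE; rewrite !uKL_sum !mulr_sumr -!big_split/= -sumrB.
by apply: eq_bigr => i _; apply: kl_bregman => //; rewrite zE !mxE.
Qed.

Lemma dotDr g x y : dot g (x + y) = dot g x + dot g y.
Proof. by rewrite -big_split/=; apply: eq_bigr => i _; rewrite mxE mulrDr. Qed.

Lemma dotZr e g x : dot g (e *: x) = e * dot g x.
Proof. by rewrite mulr_sumr; apply: eq_bigr => i _; rewrite mxE mulrCA. Qed.

Lemma dotNl g x : dot (- g) x = - dot g x.
Proof. by rewrite -sumrN; apply: eq_bigr => i _; rewrite mxE mulNr. Qed.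

(** Minimality of x is tested at a point z of the segment towards u. [uKL_bregman] turns the change
    of the objective into divergences to z; dropping the one from x and dividing by e leaves the
    claim. Only z must be positive, so x may still lie on the boundary. *)
Lemma argmin_segment V g a q x u e : segment_closed V -> nonneg_set V ->
  0 < a -> (forall i, 0 < q 0 i) ->
  is_argmin V (fun z => dot g z + a * uKL z q) x -> V u -> 0 < e < 1 ->
  (forall i, 0 < ((1 - e) *: x + e *: u) 0 i) ->
  a * uKL u ((1 - e) *: x + e *: u) <=
  dot g u + a * uKL u q - (dot g x + a * uKL x q).
Proof.
move=> Vc V0 a0 q0 [Vx xmin] Vu e01 z0; set z := _ + _ in z0 *.
have /xmin : V z by exact: Vc.
have x0 i := V0 _ i Vx; have u0 i := V0 _ i Vu.
have := uKL_bregman u0 x0 q0 z0 erefl.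
have := uKL_ge0 x0 z0.
rewrite {3}/z dotDr !dotZr => xz /(congr1 (fun r => a * r)) zE fz.
have /andP[e0 e1] := e01.
have axz : 0 <= a * ((1 - e) * uKL x z) by rewrite !mulr_ge0// ?ltW// subr_gt0.
rewrite -(ler_pM2l e0); lra.
Qed.

(* The divergence to the points of the segment from x to u stays bounded near
   x, so that no coordinate of x vanishes. *)
Lemma argmin_gt0 V g a q x u : segment_closed V -> nonneg_set V ->
  0 < a -> (forall i, 0 < q 0 i) -> V u -> (forall i, 0 < u 0 i) ->
  is_argmin V (fun z => dot g z + a * uKL z q) x -> forall i, 0 < x 0 i.
Proof.
move=> Vc V0 a0 q0 Vu u0 xmin j.
have x0 i := V0 _ i xmin.1.
rewrite lt_neqAle x0 andbT eq_sym; apply/eqP => xj0.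
set K := (dot g u + a * uKL u q - (dot g x + a * uKL x q)) / a.
have bound e : 0 < e < 1 -> u 0 j * - ln e - u 0 j <= K.
  move=> e01; have /andP[e0 e1] := e01.
  have z0 i : 0 < ((1 - e) *: x + e *: u) 0 i.
    by rewrite !mxE ltr_wpDl// ?mulr_gt0// mulr_ge0// subr_ge0 ltW.
  have := argmin_segment Vc V0 a0 q0 xmin Vu e01 z0.
  rewrite mulrC -ler_pdivlMr// -/K; apply: le_trans.
  (* Only coordinate j is kept; there the segment point equals e u_j, which produces the term - u_j
     ln e. *)
  rewrite uKL_sum (bigD1 j)//= -[leLHS]addr0 lerD//; last first.
    by rewrite sumr_ge0// => i _; rewrite kl_ge0// ltW.
  rewrite klE ?(ltW (u0 j))// !mxE xj0 mulr0 add0r lnM ?posrE//.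
  have : 0 < e * u 0 j by rewrite mulr_gt0.
  lra.
(* The case e = 1/2 gives the sign that keeps the exponential chosen below smaller than 1. *)
have K0 : 0 <= K + u 0 j.
  have h : (0 < 2^-1 :> R) && (2^-1 < 1 :> R) by apply/andP; split; lra.
  have := bound _ h; have : u 0 j * ln 2^-1 <= 0.
    by rewrite mulr_ge0_le0 ?ltW// ln_lt0.
  lra.
(* For this e the bound reads K + 1 <= K. *)
have := bound (expR (- ((K + u 0 j + 1) / u 0 j))).
rewrite expR_gt0 expR_lt1 oppr_lt0 divr_gt0 ?expRK ?opprK//=; last by lra.
move=> /(_ erefl); rewrite mulrC divfK ?gt_eqF//; lra.
Qed.

(** This is the limit of [argmin_segment] as e tends to 0: since x is positive, moving from x to the
    segment point lowers the divergence from u by at most e B. *)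
Lemma argmin_three_point V g a q x u : segment_closed V -> nonneg_set V ->
  0 < a -> (forall i, 0 < q 0 i) -> (forall i, 0 < x 0 i) -> V u ->
  is_argmin V (fun z => dot g z + a * uKL z q) x ->
  a * uKL u x <= dot g u + a * uKL u q - (dot g x + a * uKL x q).
Proof.
move=> Vc V0 a0 q0 x0 Vu xmin.
have u0 i := V0 _ i Vu.
set K := dot g u + _ - _.
set B := \sum_i (u 0 i - x 0 i) ^+ 2 / x 0 i.
have B0 : 0 <= B by rewrite sumr_ge0// => i _; rewrite divr_ge0 ?sqr_ge0// ltW.
have bound e : 0 < e < 1 -> a * uKL u x <= K + e * (a * B).
  move=> e01; have /andP[e0 e1] := e01.
  have z0 i : 0 < ((1 - e) *: x + e *: u) 0 i.
    by rewrite !mxE ltr_wpDr ?mulr_gt0// ?mulr_ge0// ?subr_gt0// ltW.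
  have := argmin_segment Vc V0 a0 q0 xmin Vu e01 z0.
  rewrite -/K; set z := _ + _ in z0 * => zK.
  rewrite -lerBlDr; apply: le_trans zK; rewrite mulrCA -mulrBr ler_pM2l//.
  rewrite lerBlDr addrC -lerBlDr !uKL_sum -sumrB mulr_sumr ler_sum// => i _.
  apply: le_trans (kl_subr_le (u0 i) (x0 i) (z0 i)) _.
  rewrite !mxE le_eqVlt; apply/orP; left; apply/eqP; ring.
apply/ler_addgt0Pr => e e0.
have aB0 : 0 <= a * B by rewrite mulr_ge0// ltW.
(* This parameter is below 1, and its product with a B is at most the slack e. *)
have c0 : 0 < e / (a * B + e + 1) < 1.
  by rewrite divr_gt0 ?ltr_pdivrMr ?mul1r//; lra.
apply: le_trans (bound _ c0) _; rewrite lerD2l.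
rewrite mulrAC ler_pdivrMr; [|lra].
by rewrite ler_wpM2l; lra.
Qed.

(** The three-point inequality compares u with the new iterate x'. Fenchel-Young moves the gain back
    to x at a cost, per unit of x, of 2/eta times 2 (eta g / 2)^2, that is eta g^2 <= eta g. *)
Lemma mirror_step_regret V eta g x x' u : segment_closed V -> nonneg_set V ->
  0 < eta <= 1 -> (forall i, 0 <= g 0 i <= 1) ->
  (forall i, 0 < x 0 i) -> (forall i, 0 < x' 0 i) -> V u ->
  is_argmin V (fun z => dot (- g) z + (2^-1 * eta)^-1 * uKL z x) x' ->
  dot g u <= (1 + eta) * dot g x + 2 / eta * (uKL u x - uKL u x').
Proof.
move=> Vc V0 /andP[eta0 eta1] g01 x0 x'0 Vu xmin.
have s0 : 0 < 2^-1 * eta by lra.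
have a0 : 0 < (2^-1 * eta)^-1 by rewrite invr_gt0.
have := argmin_three_point Vc V0 a0 x0 x'0 Vu xmin.
rewrite invfM invrK !dotNl.
suff : dot g x' - 2 / eta * uKL x' x <= (1 + eta) * dot g x by lra.
rewrite uKL_sum /dot !mulr_sumr -sumrB ler_sum// => i _.
have /andP[g0 g1] := g01 i.
have sg : 0 <= 2^-1 * eta * g 0 i <= 2^-1.
  by rewrite mulr_ge0 ?(ltW s0)//= -mulrA ler_piMr ?invr_ge0// mulr_ile1// ltW.
have c0 : 0 < 2 / eta by rewrite divr_gt0.
have := ler_wpM2l (ltW c0) (kl_conjugate_le sg (x0 i) (x'0 i)).
have -> : 2 / eta * (2^-1 * eta * g 0 i * x' 0 i - kl (x' 0 i) (x 0 i)) =
   g 0 i * x' 0 i - 2 / eta * kl (x' 0 i) (x 0 i) by field; rewrite gt_eqF.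
move=> /le_trans; apply.
have -> : 2 / eta * (x 0 i * (2^-1 * eta * g 0 i + 2 * (2^-1 * eta * g 0 i) ^+ 2))
  = (1 + eta * g 0 i) * (g 0 i * x 0 i) by field; rewrite gt_eqF.
by rewrite ler_wpM2r ?mulr_ge0 ?(ltW (x0 i))// lerD2l ler_piMr// ltW.
Qed.

End mirror_step.

(** * Geometry of the rescaled feasible set *)

Section rescaled_polytope.
Context {R : realType} {d : nat} (c : 'rV[R]_d) (M : R).
Hypotheses (c_gt0 : forall i, 0 < c 0 i) (M_gt0 : 0 < M).
Implicit Types (g x y u : 'rV[R]_d) (e : R).

Let V := rescaled_polytope c M.

Lemma polytope0 : polytope c M 0.
Proof.
split=> [i|]; first by rewrite mxE lexx ler01.
by rewrite /dot big1 ?ltW// => i _; rewrite mxE mulr0.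
Qed.

Lemma polytope_segment_closed : segment_closed (polytope c M).
Proof.
move=> x u e [x01 xM] [u01 uM] /andP[e0 e1]; split=> [i|].
  rewrite !mxE; have /andP[? ?] := x01 i; have /andP[? ?] := u01 i.
  have e1' : 0 < 1 - e by rewrite subr_gt0.
  by apply/andP; split; nra.
rewrite dotDr !dotZr; nra.
Qed.

Lemma rescaled_polytope_segment_closed : segment_closed V.
Proof.
move=> _ _ e [x Px <-] [u Pu <-] e01.
exists ((1 - e) *: x + e *: u); first exact: polytope_segment_closed.
by apply/rowP => i; rewrite !mxE; ring.
Qed.

Lemma rescaled_polytope_nonneg : nonneg_set V.
Proof.
move=> _ i [x [x01 _] <-]; have /andP[x0 _] := x01 i.
by rewrite mxE divr_ge0 ?mulr_ge0// ltW.
Qed.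

Lemma rescaled_polytope_sum_le1 x : V x -> \sum_i x 0 i <= 1.
Proof.
move=> [y [_ yM] <-]; under eq_bigr do rewrite mxE.
by rewrite -mulr_suml ler_pdivrMr// mul1r.
Qed.

(** This supplies the positive competitor of [argmin_gt0]: the constant vector with entry M / (M +
    sum c) has entries at most 1 and costs at most M. *)
Lemma rescaled_polytope_gt0 : exists2 u, V u & forall i, 0 < u 0 i.
Proof.
have s0 : 0 <= \sum_i c 0 i by rewrite sumr_ge0// => i _; exact: ltW.
have a0 : 0 < M / (M + \sum_i c 0 i) by rewrite divr_gt0// ltr_wpDr.
have a1 : M / (M + \sum_i c 0 i) <= 1.
  by rewrite ler_pdivrMr ?ltr_wpDr// mul1r lerDl.
set a := _ / _ in a0 a1.
exists (rescale c M (const_mx a)); last first.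
  by move=> i; rewrite !mxE divr_gt0// mulr_gt0.
exists (const_mx a) => //; split=> [i|]; first by rewrite mxE ltW.
rewrite /dot; under eq_bigr do rewrite mxE.
rewrite -mulr_suml mulrCA ler_piMr ?(ltW M_gt0)//.
by rewrite ler_pdivrMr ?ltr_wpDr// mul1r lerDr ltW.
Qed.

Lemma dot_rescaled g y : dot (rescaled_gradient c M g) (rescale c M y) = dot g y.
Proof.
apply: eq_bigr => i _; rewrite !mxE; field.
by rewrite !gt_eqF.
Qed.

(** From ln (1/2) <= 1/2 - 1; it lets additive constants be absorbed into ln d. *)
Lemma ln_nat_ge2 : (2 <= d)%N -> 1 <= 2 * ln (d%:R : R).
Proof.
move=> d2; have : ln (2 : R) <= ln d%:R.
  by rewrite ler_ln ?posrE ?ltr0n ?ler_nat// (leq_trans _ d2).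
have := @ln_le_subr1 R 2^-1.
rewrite lnV ?posrE// invr_gt0 => /(_ (ltr0Sn _ 1)); lra.
Qed.

(** As u ln u <= 0 in each coordinate and the coordinates sum to at most 1, the divergence is at
    most ln d + 1. *)
Lemma uKL_uniform_le u : (2 <= d)%N -> V u ->
  uKL u (const_mx d%:R^-1) <= 3 * ln d%:R.
Proof.
move=> d2 Vu; have u0 i := rescaled_polytope_nonneg i Vu.
have d0 : 0 < (d%:R : R) by rewrite ltr0n (leq_trans _ d2).
have u1 i : u 0 i <= 1.
  apply: le_trans (rescaled_polytope_sum_le1 Vu).
  by rewrite (bigD1 i)//= lerDl sumr_ge0.
have lnd := ln_nat_ge2 d2.
have -> : 3 * ln (d%:R : R) = ln d%:R * 1 + 2 * ln d%:R by ring.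
apply: (@le_trans _ _ (ln d%:R * (\sum_i u 0 i) + 1)); last first.
  rewrite lerD// ler_wpM2l ?rescaled_polytope_sum_le1//; lra.
have dV1 : \sum_(i < d) d%:R^-1 = 1 :> R.
  by rewrite sumr_const card_ord -[_ *+ d]mulr_natl mulfV ?gt_eqF.
rewrite -[X in _ <= _ + X]dV1 uKL_sum mulr_sumr -big_split ler_sum// => i _ /=.
rewrite mxE klE ?invr_gt0// lnV ?posrE//.
have : u 0 i * ln (u 0 i) <= 0 by rewrite mulr_ge0_le0 ?ln_le0.
have := u0 i; lra.
Qed.

End rescaled_polytope.

(** * Pathwise regret up to a stopping round *)

Section omd_regret.
Context {R : realType} {d : nat} (c : 'rV[R]_d) (M eta : R).
Hypotheses (d_ge2 : (2 <= d)%N) (c_gt0 : forall i, 0 < c 0 i) (M_gt0 : 0 < M)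
  (eta01 : 0 < eta <= 1).
Variables (H y : nat -> 'rV[R]_d).
Hypothesis omd : omd_iterates (rescaled_polytope c M) (2^-1 * eta)
  (fun t => rescaled_gradient c M (H t)) (fun t => rescale c M (y t)).

Let V := rescaled_polytope c M.
Let x t := rescale c M (y t).

(** The initial projection is a mirror step with zero gradient and unit weight, so the lemmas on
    steps cover it. *)
Let x1_argmin : is_argmin V
  (fun z => dot 0 z + 1 * uKL z (const_mx d%:R^-1)) (x 1%N).
Proof.
suff -> : (fun z : 'rV[R]_d => dot 0 z + 1 * uKL z (const_mx d%:R^-1)) =
    (fun z => uKL z (const_mx d%:R^-1)) by exact: omd.1.
apply/funext => z; rewrite mul1r /dot big1 ?add0r// => i _.
by rewrite mxE mul0r.
Qed.

Let uniform_gt0 (i : 'I_d) : 0 < (const_mx d%:R^-1 : 'rV[R]_d) 0 i.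
Proof. by rewrite mxE invr_gt0 ltr0n (leq_trans _ d_ge2). Qed.

(** Each iterate is the reference point of the next divergence, so positivity propagates by
    induction. *)
Lemma omd_iterates_gt0 t i : (0 < t)%N -> 0 < x t 0 i.
Proof.
have [u Vu u0] := rescaled_polytope_gt0 c_gt0 M_gt0.
have Vc := @rescaled_polytope_segment_closed _ _ c M.
have V0 := rescaled_polytope_nonneg c_gt0 M_gt0.
have /andP[eta0 _] := eta01.
case: t => // t _; elim: t i => [|t IH] i.
  exact: (argmin_gt0 Vc V0 ltr01 uniform_gt0 Vu u0 x1_argmin).
apply: (argmin_gt0 Vc V0 _ IH Vu u0 (omd.2 t.+1 _)) => //.
by rewrite invr_gt0 mulr_gt0.
Qed.

(* [b t] tells whether round t takes place; the rounds stop for good. *)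
Lemma omd_stopped_regret (b : nat -> bool) ystar N :
  (forall t i, (0 < t)%N -> 0 <= H t 0 i * (M / c 0 i) <= 1) ->
  (forall t, b t.+1 -> b t) -> polytope c M ystar ->
  \sum_(1 <= t < N.+1)
    (b t)%:R * (dot (H t) ystar - (1 + eta) * dot (H t) (y t)) <=
  6 * ln d%:R / eta.
Proof.
move=> H01 b_stop Pystar; set u := rescale c M ystar.
have Vu : V u by exists ystar.
have Vc := @rescaled_polytope_segment_closed _ _ c M.
have V0 := rescaled_polytope_nonneg c_gt0 M_gt0.
have /andP[eta0 _] := eta01.
have u0 i := V0 _ i Vu.
have D0 t : (0 < t)%N -> 0 <= uKL u (x t).
  by move=> t0; rewrite uKL_ge0// => i; exact: omd_iterates_gt0.
have step t : (0 < t)%N -> dot (H t) ystar - (1 + eta) * dot (H t) (y t) <=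
    2 / eta * (uKL u (x t) - uKL u (x t.+1)).
  move=> t0; rewrite -(dot_rescaled c_gt0 M_gt0 _ ystar).
  rewrite -(dot_rescaled c_gt0 M_gt0 _ (y t)) lerBlDl.
  apply: (mirror_step_regret Vc V0 eta01 _ _ _ Vu (omd.2 t t0)) => i.
  - by rewrite mxE -mulrA mulrCA; exact: H01.
  - exact: omd_iterates_gt0.
  - exact: omd_iterates_gt0.
(* Pythagorean inequality: projecting the uniform point on V does not increase the divergence from
   u. *)
have D1 : uKL u (x 1%N) <= 3 * ln d%:R.
  apply: le_trans (uKL_uniform_le c_gt0 M_gt0 d_ge2 Vu).
  have x0 i := omd_iterates_gt0 i (ltn0Sn 0).
  have := argmin_three_point Vc V0 ltr01 uniform_gt0 x0 Vu x1_argmin.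
  have := uKL_ge0 (fun i => ltW (x0 i)) uniform_gt0.
  have dot0 z : dot (0 : 'rV[R]_d) z = 0.
    by rewrite /dot big1// => i _; rewrite mxE mul0r.
  rewrite !dot0; lra.
(* The induction retains the last divergence while the rounds go on, for the next round to cancel;
   once they stop, its weight is 0. *)
suff telescope : \sum_(1 <= t < N.+1)
    (b t)%:R * (dot (H t) ystar - (1 + eta) * dot (H t) (y t)) <=
    2 / eta * (uKL u (x 1%N) - (b N)%:R * uKL u (x N.+1)).
  apply: le_trans telescope _.
  have -> : 6 * ln d%:R / eta = 2 / eta * (3 * ln d%:R) by ring.
  rewrite ler_wpM2l ?divr_ge0 ?(ltW eta0)//.
  have : 0 <= (b N)%:R * uKL u (x N.+1) by rewrite mulr_ge0// D0.
  lra.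
elim: N => [|N IH].
  rewrite big_geq// mulr_ge0 ?divr_ge0 ?(ltW eta0)//.
  by case: (b 0%N); rewrite ?mul1r ?subrr// mul0r subr0 D0.
rewrite big_nat_recr//=.
apply: le_trans (lerD IH (ler_wpM2l (ler0n _ _) (step N.+1 isT))) _.
rewrite mulrCA -mulrDr ler_wpM2l ?divr_ge0 ?(ltW eta0)//.
have := D0 N.+1 isT; have := b_stop N.
by case: (b N.+1) => [/(_ isT)->|_] //=; case: (b N) => /=; lra.
Qed.

End omd_regret.

(** * Pulling bounded factors out of conditional expectations *)

Section conditional_expectation.
Context {R : realType} {disp : measure_display} {T : measurableType disp}.
Context (P : probability T R) (E : set (set T)).
Hypotheses (sigmaE : sigma_algebra setT E) (E_measurable : E `<=` measurable).
Implicit Types (X Y Z W : T -> R).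

Lemma measurable_wrt_preimage Y (B : set R) :
  measurable_wrt E Y -> measurable B -> E (Y @^-1` B).
Proof.
move=> mY mB; have := mY measurableT _ mB.
by rewrite setTI measurable_g_measurableTypeE.
Qed.

Lemma measurable_wrt_indic (A : set T) : E A -> measurable_wrt E (\1_A : T -> R).
Proof.
move=> EA; apply: (@measurable_indic _ (g_sigma_algebraType E) R).
by rewrite measurable_g_measurableTypeE.
Qed.

Lemma measurable_wrt_measurable Y : measurable_wrt E Y -> measurable_fun setT Y.
Proof.
move=> mY _ B mB; rewrite setTI.
exact: E_measurable (measurable_wrt_preimage mY mB).
Qed.

Lemma integrable_mul_bounded01 Y X : measurable_fun setT Y ->
  (forall w, 0 <= Y w <= 1) -> P.-integrable setT (EFin \o X) ->
  P.-integrable setT (EFin \o (fun w => Y w * X w)).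
Proof.
move=> mY Y01 iX.
apply: (le_integrable measurableT _ _ iX) => [|w _ /=].
  apply/measurable_EFinP/measurable_funM => //.
  by apply/measurable_EFinP; exact: measurable_int iX.
have /andP[Y0 Y1] := Y01 w.
by rewrite lee_fin normrM ger0_norm// ler_piMl.
Qed.

(* Doubling Y and removing its leading binary digit preserves the hypotheses on
   Y and doubles the integral, which is bounded by the norm of W. *)
Lemma Rintegral_mul_eq0 W Y : P.-integrable setT (EFin \o W) ->
  (forall A, E A -> \int[P]_(w in A) W w = 0) ->
  measurable_wrt E Y -> (forall w, 0 <= Y w <= 1) ->
  \int[P]_w (Y w * W w) = 0.
Proof.
move=> iW W0 mY Y01.
have digits n Y' : measurable_wrt E Y' -> (forall w, 0 <= Y' w <= 1) ->
    2 ^+ n * `|\int[P]_w (Y' w * W w)| <= \int[P]_w `|W w|.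
  elim: n Y' => [|n IH] Y' mY' Y'01.
    have iYW := integrable_mul_bounded01 (measurable_wrt_measurable mY') Y'01 iW.
    rewrite mul1r (le_trans (le_normr_Rintegral measurableT iYW))//.
    apply: le_Rintegral => //; [exact: integrable_norm..|] => w _.
    have /andP[Y0 Y1] := Y'01 w.
    by rewrite normrM ger0_norm// ler_piMl.
  pose A := [set w | 2^-1 <= Y' w].
  have EA : E A.
    have -> : A = Y' @^-1` `[2^-1, +oo[.
      by apply/seteqP; split=> w; rewrite /A/= in_itv/= andbT.
    exact: measurable_wrt_preimage.
  have mA := E_measurable EA.
  have mD : measurable_wrt E (fun w => 2 * Y' w - \1_A w).
    apply: measurable_funB; last exact: measurable_wrt_indic.
    exact: measurable_funM.
  have iYW := integrable_mul_bounded01 (measurable_wrt_measurable mY') Y'01 iW.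
  have iAW : P.-integrable setT (EFin \o (fun w => \1_A w * W w)).
    apply: integrable_mul_bounded01 => //.
    by move=> w; rewrite indicE; case: (w \in A); rewrite ?lexx ?ler01.
  have := IH _ mD.
  under eq_Rintegral do rewrite mulrBl -mulrA.
  rewrite RintegralB//; last exact: (integrableZl measurableT 2 iYW).
  rewrite RintegralZl//.
  (* The removed digit contributes nothing, since A belongs to E. *)
  have -> : \int[P]_w (\1_A w * W w) = 0.
    rewrite -(W0 _ EA) [RHS]Rintegral_mkcond; apply: eq_Rintegral => w _.
    by rewrite indicE patchE; case: (w \in A); rewrite ?mul1r ?mul0r.
  rewrite subr0 normrM ger0_norm// mulrA -exprSr; apply.
  move=> w; have /andP[Y0 Y1] := Y'01 w; rewrite indicE.
  have [wA|wA] := boolP (w \in A).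
    by move: wA; rewrite inE /A/= => wA; apply/andP; split; lra.
  move: wA; rewrite notin_setE /A/= => /negP; rewrite -ltNge => wA.
  by apply/andP; split; lra.
apply/eqP; rewrite -normr_eq0; apply/eqP/le_anti; rewrite normr_ge0 andbT.
rewrite leNgt; apply/negP => I0.
set I := `|_| in I0; set B := \int[P]_w `|W w|.
have B0 : 0 <= B / I by rewrite divr_ge0 ?(ltW I0)// /B Rintegral_ge0.
(* For an integer n > B / I, the digit bound would give B < n I <= 2^n I <= B. *)
have := archi_boundP B0; rewrite ltr_pdivrMr// ltNge => /negP; apply.
apply: le_trans (digits (Num.Def.archi_bound (B / I)) _ mY Y01).
by rewrite ler_wpM2r ?(ltW I0)// -natrX ler_nat ltnW// ltn_expl.
Qed.

(** The difference Z - X integrates to 0 over every set of E, so [Rintegral_mul_eq0] applies to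
    it. *)
Lemma condexp_pull_out X Z Y : is_condexp P E X Z -> measurable_wrt E Y ->
  (forall w, 0 <= Y w <= 1) ->
  (\int[P]_w (Y w * Z w)%:E = \int[P]_w (Y w * X w)%:E)%E.
Proof.
move=> [iX iZ _ XZ] mY Y01.
have mYT := measurable_wrt_measurable mY.
have iYX := integrable_mul_bounded01 mYT Y01 iX.
have iYZ := integrable_mul_bounded01 mYT Y01 iZ.
have iS A f : E A -> P.-integrable setT f -> P.-integrable A f.
  by move=> EA; apply: integrableS => //; exact: E_measurable.
have := @Rintegral_mul_eq0 (fun w => Z w - X w) Y.
under eq_Rintegral do rewrite mulrBr.
rewrite RintegralB// => YZX0.
rewrite -[LHS]fineK ?integrable_fin_num// -[RHS]fineK ?integrable_fin_num//.
congr EFin; apply/subr0_eq/YZX0 => //; first exact: (integrableB measurableT iZ iX).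
move=> A EA; have mA := E_measurable EA.
rewrite RintegralB//; [|exact: iS..].
by rewrite /Rintegral XZ// subrr.
Qed.

Lemma integrable_dot {d : nat} (X Y : T -> 'rV[R]_d) :
  (forall i, P.-integrable setT (EFin \o (fun w => X w 0 i))) ->
  (forall i, measurable_fun setT (fun w => Y w 0 i)) ->
  (forall w i, 0 <= Y w 0 i <= 1) ->
  P.-integrable setT (EFin \o (fun w => dot (X w) (Y w))).
Proof.
move=> iX mY Y01.
have -> : EFin \o (fun w => dot (X w) (Y w)) =
    (fun w => \sum_i (Y w 0 i * X w 0 i)%:E)%E.
  apply/funext => w /=; rewrite sumEFin; congr EFin.
  by apply: eq_bigr => i _; rewrite mulrC.
apply: integrable_sum => // i _; exact: integrable_mul_bounded01.
Qed.

Lemma vector_condexp_pull_out {d : nat} (X Z Y : T -> 'rV[R]_d) :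
  is_vector_condexp P E X Z -> vector_measurable_wrt E Y ->
  (forall w i, 0 <= Y w 0 i <= 1) ->
  (\int[P]_w (dot (Z w) (Y w))%:E = \int[P]_w (dot (X w) (Y w))%:E)%E.
Proof.
move=> XZ mY Y01.
have dotE (U : T -> 'rV[R]_d) :
    (forall i, P.-integrable setT (EFin \o (fun w => U w 0 i))) ->
    (\int[P]_w (dot (U w) (Y w))%:E =
     \sum_i \int[P]_w (Y w 0 i * U w 0 i)%:E)%E.
  move=> iU; rewrite -integral_sum//=.
    apply: eq_integral => w _; rewrite sumEFin; congr EFin.
    by apply: eq_bigr => i _; rewrite mulrC.
  move=> i; apply: integrable_mul_bounded01 => //.
  exact: measurable_wrt_measurable (mY i).
rewrite !dotE; [|by move=> i; case: (XZ i)..].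
by apply: eq_bigr => i _; exact: condexp_pull_out.
Qed.

End conditional_expectation.

(** * Comparison of integrals almost everywhere *)

Section ae_domination.
Context {R : realType} {disp : measure_display} {T : measurableType disp}.
Context (mu : {measure set T -> \bar R}).
Implicit Types f g : T -> R.

Lemma ae_le_integral f g :
  mu.-integrable setT (EFin \o f) -> mu.-integrable setT (EFin \o g) ->
  {ae mu, forall w, f w <= g w} ->
  (\int[mu]_w (f w)%:E <= \int[mu]_w (g w)%:E)%E.
Proof.
move=> intf intg [N [mN muN fgN]].
rewrite (negligible_integral mN _ intf)// (negligible_integral mN _ intg)//.
have mTN : measurable (setT `\` N) by exact: measurableD.
apply: le_integral => //.
- exact: integrableS intf.
- exact: integrableS intg.
- move=> w; rewrite inE => -[_ Nw] /=; rewrite lee_fin.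
  by apply: contrapT => fg; apply/Nw/fgN.
Qed.

(** It makes the stopped gain of the comparator integrable in a round where that of the play is. *)
Lemma ae_ge0_le_integrable f g : measurable_fun setT f ->
  (forall w, 0 <= f w) -> mu.-integrable setT (EFin \o g) ->
  {ae mu, forall w, f w <= g w} -> mu.-integrable setT (EFin \o f).
Proof.
move=> mf f0 intg fg; apply/integrableP; split; first exact/measurable_EFinP.
have /integrableP[mg] := intg; apply: le_lt_trans.
apply: ae_ge0_le_integral => //.
- by apply: measurableT_comp => //; exact/measurable_EFinP.
- exact: measurableT_comp.
apply: filterS fg => w fg _ /=.
by rewrite lee_fin ger0_norm// (le_trans fg)// ler_norm.
Qed.

End ae_domination.

(** * Stopping times and stopped gains *)

Section stopped_gain.
Context {R : realType} {disp : measure_display} {T : measurableType disp}.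
Context (P : probability T R) (F : nat -> set (set T)) (tau : T -> option nat).
Hypotheses (filtrationF : is_filtration F) (stop : is_stopping_time F tau).

Lemma filtration_subset t : F t `<=` measurable.
Proof. by case: filtrationF. Qed.

Lemma filtration_sigma t : sigma_algebra setT (F t).
Proof. by case: filtrationF. Qed.

(** Round t takes place unless tau <= t - 1, an event already decided in the history F (t - 1). *)
Lemma before_filtration t : (0 < t)%N -> F t [set w | before t (tau w)].
Proof.
case: t => // t _; case: filtrationF => sigmaF _ Fmono; apply: Fmono.
have -> : [set w | before t.+1 (tau w)] =
    setT `\` [set w | exists2 n, tau w = Some n & (n <= t)%N].
  apply/seteqP; split=> w /=.
    case: (tau w) => [m|] /=; last by move=> _; split=> // -[].
    by move=> tm; split=> // -[n [<-]]; rewrite leqNgt tm.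
  move=> [_ tauw]; case tauE : (tau w) => [m|] //=.
  by rewrite ltnNge; apply/negP => mt; apply: tauw; exists m.
by case: (sigmaF t) => _ + _; apply; exact: stop.
Qed.

Lemma before_measurable_wrt t : (0 < t)%N ->
  measurable_wrt (F t) (fun w => (before t (tau w))%:R : R).
Proof.
move=> t0; have -> : (fun w => (before t (tau w))%:R : R) =
    \1_[set w | before t (tau w)].
  by apply/funext => w; rewrite indicE mem_setE.
apply: measurable_wrt_indic; first exact: filtration_sigma.
exact: before_filtration.
Qed.

Lemma before_measurable t : (0 < t)%N ->
  measurable_fun setT (fun w => (before t (tau w))%:R : R).
Proof.
move=> t0; apply: (measurable_wrt_measurable _ (@filtration_subset t)).
  exact: filtration_sigma.
exact: before_measurable_wrt.
Qed.

Lemma expected_gainE (gain : nat -> T -> R) :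
  (forall t w, (0 < t)%N -> 0 <= gain t w) ->
  (forall t, (0 < t)%N -> measurable_fun setT (gain t)) ->
  expected_gain P tau gain =
  (\sum_(1 <= t <oo) \int[P]_w ((before t (tau w))%:R * gain t w)%:E)%E.
Proof.
move=> gain0 mgain.
(* The value 0 at index 0 extends measurability and nonnegativity to all indices, as the exchange of
   sum and integral requires. *)
pose f t w := if (0 < t)%N then ((before t (tau w))%:R * gain t w)%:E else 0%E.
have -> : expected_gain P tau gain = (\int[P]_w \sum_(t <oo) f t w)%E.
  apply: eq_integral => w _.
  rewrite eseries_mkcond eseries_cond eseries_mkcond.
  apply: eq_eseriesr => t _; rewrite /f /=.
  by case: ifP => // _; case: ifP => _; rewrite ?mul1r ?mul0r.
rewrite integral_nneseries//; first last.
- move=> t w _; rewrite /f; case: ifPn => // t0.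
  by rewrite lee_fin mulr_ge0// gain0.
- move=> [|t]; rewrite /f/=; first exact: measurable_cst.
  apply/measurable_EFinP/measurable_funM; last exact: mgain.
  exact: before_measurable.
rewrite [RHS]eseries_cond [RHS]eseries_mkcond; apply: eq_eseriesr => t _ /=.
by rewrite /f; case: (0 < t)%N => //; exact: integral0.
Qed.

End stopped_gain.

(** * Regret in expectation *)

Section online_regret.
Context {R : realType} {d : nat} {disp : measure_display}.
Context {T : measurableType disp} (P : probability T R).
Variables (c : 'rV[R]_d) (M eta : R) (F : nat -> set (set T)).
Variables (y : nat -> T -> 'rV[R]_d) (h : nat -> T -> 'rV[R]_d -> R).
Variables (H grad : nat -> T -> 'rV[R]_d) (tau : T -> option nat).
Variable ystar : 'rV[R]_d.
Implicit Types (G : nat -> T -> 'rV[R]_d).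
Hypotheses (d_ge2 : (2 <= d)%N) (c_gt0 : forall i, 0 < c 0 i) (M_gt0 : 0 < M).
Hypothesis game : online_game P c M F y h H grad.
Hypothesis H01 : {ae P, forall w, forall (t : nat) (i : 'I_d), (0 < t)%N ->
  0 <= H t w 0 i * (M / c 0 i) <= 1}.
Hypothesis eta01 : 0 < eta <= 1.
Hypothesis omd : forall w, omd_iterates (rescaled_polytope c M) (2^-1 * eta)
  (fun t => rescaled_gradient c M (H t w)) (fun t => rescale c M (y t w)).
Hypothesis stop : is_stopping_time F tau.
Hypothesis Pystar : polytope c M ystar.

Let beta t w : R := (before t (tau w))%:R.
Let K := 6 * ln d%:R / eta.
(** The stopping indicator multiplies the points, not the gradients: the products keep entries in
    [0,1] and stay in the history, as pulling out requires. *)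
Let play t w := beta t w *: y t w.
Let star t w := beta t w *: ystar.
Let regret (G : nat -> T -> 'rV[R]_d) t w :=
  dot (G t w) (star t w) - (1 + eta) * dot (G t w) (play t w).

Let filtrationF : is_filtration F := game_filtration game.
Let sub t := filtration_subset filtrationF (t := t).
Let sigma t := filtration_sigma filtrationF t.

Let beta01 t w : 0 <= beta t w <= 1.
Proof. by rewrite /beta; case: before; rewrite ?lexx ?ler01. Qed.

Let regretE G t w : regret G t w =
  beta t w * (dot (G t w) ystar - (1 + eta) * dot (G t w) (y t w)).
Proof. by rewrite /regret !dotZr; ring. Qed.

Let scaled01 t w z i : polytope c M z -> 0 <= (beta t w *: z) 0 i <= 1.
Proof.
move=> [z01 _]; have /andP[z0 z1] := z01 i; have /andP[b0 b1] := beta01 t w.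
by rewrite mxE mulr_ge0// mulr_ile1.
Qed.

Let star01 t w i : 0 <= star t w 0 i <= 1.
Proof. exact: scaled01. Qed.

Let play01 t w i : (0 < t)%N -> 0 <= play t w 0 i <= 1.
Proof. by move=> t0; apply: scaled01; exact: (play_feasible game). Qed.

Let star_wrt t : (0 < t)%N -> vector_measurable_wrt (F t) (star t).
Proof.
move=> t0 i; rewrite /measurable_wrt /star.
under eq_fun do rewrite mxE.
apply: measurable_funM => //.
exact: (before_measurable_wrt filtrationF stop t0).
Qed.

Let play_wrt t : (0 < t)%N -> vector_measurable_wrt (F t) (play t).
Proof.
move=> t0 i; rewrite /measurable_wrt /play.
under eq_fun do rewrite mxE.
apply: measurable_funM; last exact: (play_adapted game t0 i).
exact: (before_measurable_wrt filtrationF stop t0).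
Qed.

Let wrtT t (X : T -> 'rV[R]_d) : vector_measurable_wrt (F t) X ->
  forall i, measurable_fun setT (fun w => X w 0 i).
Proof.
by move=> mX i; exact: (measurable_wrt_measurable (sigma t) (@sub t) (mX i)).
Qed.

Let int_dot G t : (0 < t)%N ->
  (forall i, P.-integrable setT (EFin \o (fun w => G t w 0 i))) ->
  P.-integrable setT (EFin \o (fun w => dot (G t w) (star t w))) /\
  P.-integrable setT (EFin \o (fun w => dot (G t w) (play t w))).
Proof.
move=> t0 iG; split; apply: integrable_dot => //.
- by apply: wrtT; exact: star_wrt.
- by apply: wrtT; exact: play_wrt.
- by move=> w i; exact: play01.
Qed.

Let integrable_regret G t : (0 < t)%N ->
  (forall i, P.-integrable setT (EFin \o (fun w => G t w 0 i))) ->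
  P.-integrable setT (EFin \o regret G t).
Proof.
move=> t0 iG; have [istar iplay] := int_dot t0 iG.
exact: (integrableB measurableT istar (integrableZl measurableT (1 + eta) iplay)).
Qed.

Let integral_regret t : (0 < t)%N ->
  (\int[P]_w (regret grad t w)%:E = \int[P]_w (regret H t w)%:E)%E.
Proof.
move=> t0; have ce := observation_condexp game t0.
have iH i := let: And4 iH _ _ _ := ce i in iH.
have iG i := let: And4 _ iG _ _ := ce i in iG.
have E (G : nat -> T -> 'rV[R]_d) :
    (forall i, P.-integrable setT (EFin \o (fun w => G t w 0 i))) ->
    (\int[P]_w (regret G t w)%:E = \int[P]_w (dot (G t w) (star t w))%:E -
      (1 + eta)%:E * \int[P]_w (dot (G t w) (play t w))%:E)%E.
  move=> iG'; have [istar iplay] := int_dot t0 iG'.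
  rewrite -integralZl// -integralB//; exact: integrableZl.
rewrite (E grad iG) (E H iH).
rewrite (vector_condexp_pull_out (sigma t) (@sub t) ce (star_wrt t0))//.
rewrite (vector_condexp_pull_out (sigma t) (@sub t) ce (play_wrt t0))//.
by move=> w i; exact: play01.
Qed.

Let K_ge0 : 0 <= K.
Proof.
have /andP[eta0 _] := eta01; have := ln_nat_ge2 (R := R) d_ge2.
by move=> ?; rewrite divr_ge0 ?(ltW eta0)//; lra.
Qed.

(** The pathwise bound concerns the observations, so each integral is first moved from [grad] to H;
    the bound K is then integrated over total mass 1. *)
Let sum_integral_regret_le N :
  (\sum_(1 <= t < N) \int[P]_w (regret grad t w)%:E <= K%:E)%E.
Proof.
case: N => [|N]; first by rewrite big_geq// lee_fin K_ge0.
have iR t : (0 < t)%N -> P.-integrable setT (EFin \o regret H t).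
  move=> t0; apply: integrable_regret => // i.
  by case: (observation_condexp game t0 i).
rewrite (eq_big_nat _ _ (F2 := fun t => \int[P]_w (regret H t w)%:E)%E); last first.
  by move=> t /andP[t0 _]; rewrite integral_regret.
rewrite big_add1 -integral_sum//=; last by move=> t; exact: iR.
under eq_integral do rewrite sumEFin.
apply: (@le_trans _ _ (\int[P]_w (cst K w)%:E)%E); last first.
  by rewrite -[leRHS]mule1 -(probability_setT P) -integral_cst.
apply: ae_le_integral.
- have -> : EFin \o (fun w => \sum_(0 <= t < N) regret H t.+1 w) =
      (fun w => \sum_(0 <= t < N) (regret H t.+1 w)%:E)%E.
    by apply/funext => w /=; rewrite sumEFin.
  by apply: integrable_sum => // t _; exact: iR.
- exact: finite_measure_integrable_cst.
apply: filterS H01 => w Hw.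
rewrite -(big_add1 _ _ 0 N.+1 xpredT (regret H ^~ w)).
under eq_bigr do rewrite regretE.
apply: (omd_stopped_regret d_ge2 c_gt0 M_gt0 eta01 (omd w)) => //.
by move=> t; case: (tau w) => //= n; exact: ltnW.
Qed.

Let stopped_play t := (\int[P]_w (beta t w * h t w (y t w))%:E)%E.
Let stopped_star t := (\int[P]_w (beta t w * h t w ystar)%:E)%E.

Let h_play_ge0 t w : (0 < t)%N -> 0 <= h t w (y t w).
Proof.
by move=> t0; apply: (gain_ge0 game) => //; exact: (play_feasible game).
Qed.

Let h_star_ge0 t w : (0 < t)%N -> 0 <= h t w ystar.
Proof. by move=> t0; exact: (gain_ge0 game). Qed.

Let measurable_h_play t : (0 < t)%N ->
  measurable_fun setT (fun w => h t w (y t w)).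
Proof.
move=> t0; apply: (measurable_wrt_measurable (sigma t) (@sub t)).
exact: (gain_play_adapted game).
Qed.

Let measurable_h_star t : (0 < t)%N ->
  measurable_fun setT (fun w => h t w ystar).
Proof.
move=> t0; apply: (measurable_wrt_measurable (sigma t) (@sub t)).
exact: (gain_adapted game).
Qed.

Let measurable_beta t : (0 < t)%N -> measurable_fun setT (beta t).
Proof. exact: (before_measurable filtrationF stop). Qed.

Let stopped_play_ge0 t : (0 < t)%N -> (0 <= stopped_play t)%E.
Proof.
by move=> t0; apply: integral_ge0 => w _; rewrite lee_fin mulr_ge0// h_play_ge0.
Qed.

Let stopped_star_ge0 t : (0 < t)%N -> (0 <= stopped_star t)%E.
Proof.
by move=> t0; apply: integral_ge0 => w _; rewrite lee_fin mulr_ge0// h_star_ge0.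
Qed.

(* The subgradient inequality is used at ystar and at 0; the latter bounds
   dot (grad t w) (y t w) by the gain of the play. *)
Let round_regret t : (0 < t)%N -> (stopped_play t < +oo)%E ->
  (stopped_star t <=
   (1 + eta)%:E * stopped_play t + \int[P]_w (regret grad t w)%:E)%E.
Proof.
move=> t0 fin_play; have /andP[eta0 _] := eta01.
have b0 w : 0 <= beta t w by have /andP[] := beta01 t w.
have ip : P.-integrable setT (EFin \o (fun w => beta t w * h t w (y t w))).
  apply/integrableP; split.
    apply/measurable_EFinP/measurable_funM; first exact: measurable_beta.
    exact: measurable_h_play.
  apply: le_lt_trans fin_play; rewrite le_eqVlt; apply/orP; left; apply/eqP.
  by apply: eq_integral => w _ /=; rewrite ger0_norm// mulr_ge0// h_play_ge0.
have ir : P.-integrable setT (EFin \o regret grad t).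
  by apply: integrable_regret => // i; case: (observation_condexp game t0 i).
have iZ := integrableZl measurableT (1 + eta) ip.
have isum := integrableD measurableT iZ ir.
rewrite -integralZl// -integralD//.
have le_ae : {ae P, forall w, beta t w * h t w ystar <=
    (1 + eta) * (beta t w * h t w (y t w)) + regret grad t w}.
  apply: filterS (observation_subgradient game t0) => w sg.
  rewrite regretE mulrCA -mulrDr ler_wpM2l//.
  have := sg _ Pystar; have := sg _ (polytope0 c M_gt0).
  have := gain_ge0 game w t0 (polytope0 c M_gt0).
  have dotN z : dot (grad t w) (- z) = - dot (grad t w) z.
    by rewrite -scaleN1r dotZr mulN1r.
  rewrite sub0r dotDr !dotN; nra.
apply: ae_le_integral => //.
apply: (ae_ge0_le_integrable _ _ isum le_ae) => [|w].
  apply: measurable_funM; first exact: measurable_beta.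
  exact: measurable_h_star.
by rewrite mulr_ge0// h_star_ge0.
Qed.

Lemma expected_regret : (expected_gain P tau (fun t w => h t w (y t w)) >=
   (1 - eta)%:E * expected_gain P tau (fun t w => h t w ystar) - K%:E)%E.
Proof.
have /andP[eta0 eta1] := eta01; have K0 := K_ge0.
rewrite !(expected_gainE P filtrationF stop)//.
rewrite -/(stopped_play _).
set E1 := (\sum_(1 <= t <oo) stopped_play t)%E.
set E2 := (\sum_(1 <= t <oo) stopped_star t)%E.
have E10 : (0 <= E1)%E by apply: nneseries_ge0 => t t0 _; exact: stopped_play_ge0.
have E20 : (0 <= E2)%E by apply: nneseries_ge0 => t t0 _; exact: stopped_star_ge0.
(* An infinite gain of the algorithm settles the claim; otherwise each [stopped_play t] is finite,
   as [round_regret] requires. *)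
have [->|E1oo] := eqVneq E1 +oo%E; first by rewrite leey.
have partial N : (\sum_(1 <= t < N) stopped_play t <= E1)%E.
  by apply: nneseries_lim_ge => t t0 _; exact: stopped_play_ge0.
have E2le : (E2 <= (1 + eta)%:E * E1 + K%:E)%E.
  apply: lime_le.
    by apply: is_cvg_nneseries => t t0 _; exact: stopped_star_ge0.
  apply: nearW => N.
  apply: (@le_trans _ _ (\sum_(1 <= t < N)
      ((1 + eta)%:E * stopped_play t + \int[P]_w (regret grad t w)%:E))%E).
    rewrite big_nat_cond [leRHS]big_nat_cond; apply: lee_sum => t.
    move=> /andP[/andP[t0 _] _]; apply: round_regret => //.
    rewrite (le_lt_trans _ (_ : E1 < +oo)%E) ?ltey//.
    apply: le_trans (partial t.+1); rewrite big_nat_recr//= leeDr//.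
    rewrite big_nat_cond; apply: sume_ge0 => s /andP[/andP[s0 _] _].
    exact: stopped_play_ge0.
  rewrite big_split/=; apply: leeD; last exact: sum_integral_regret_le.
  rewrite big_nat_cond -ge0_sume_distrr.
    by rewrite -big_nat_cond lee_pmul2l ?lte_fin ?addr_gt0.
  by move=> t /andP[/andP[t0 _] _]; exact: stopped_play_ge0.
(* The bound [E2le] also excludes E2 = +oo, so real arithmetic remains. *)
move: E1 E2 E10 E20 E1oo {partial} E2le => [e1| |]// [e2| |]//.
rewrite !lee_fin => e10 e20 _ e2le.
have : (1 - eta) * e2 <= (1 - eta) * ((1 + eta) * e1 + K).
  by rewrite ler_wpM2l// subr_ge0.
have : 0 <= eta * K by rewrite mulr_ge0// ltW.
have : 0 <= eta ^+ 2 * e1 by rewrite mulr_ge0// sqr_ge0.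
nra.
Qed.

End online_regret.

Theorem theorem2p2 (R : realType) :
  exists kappa C : R, [/\ 0 < kappa, 0 < C &
  forall (d : nat) (c : 'rV[R]_d) (M : R),
  (2 <= d)%N -> (forall i, 0 < c 0 i) -> 0 < M ->
  forall (disp : measure_display) (T : measurableType disp)
    (P : probability T R) (F : nat -> set (set T))
    (y : nat -> T -> 'rV[R]_d) (h : nat -> T -> 'rV[R]_d -> R)
    (H grad : nat -> T -> 'rV[R]_d),
  online_game P c M F y h H grad ->
  {ae P, forall w, forall (t : nat) (i : 'I_d), (0 < t)%N ->
    0 <= H t w 0 i * (M / c 0 i) <= 1} ->
  forall eta : R, 0 < eta <= 1 ->
  (forall w, omd_iterates (rescaled_polytope c M) (kappa * eta)
     (fun t => rescaled_gradient c M (H t w))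
     (fun t => rescale c M (y t w))) ->
  forall tau : T -> option nat, is_stopping_time F tau ->
  forall ystar : 'rV[R]_d, polytope c M ystar ->
  (expected_gain P tau (fun t w => h t w (y t w)) >=
   (1 - eta)%:E * expected_gain P tau (fun t w => h t w ystar)
     - (C * ln d%:R / eta)%:E)%E].
Proof.
(* Step eta / 2 keeps the scaled gradients within [0, 1/2]; the constant 6 is the factor 2 of 2/eta
   times the 3 of the initial divergence. *)
exists 2^-1, 6; split=> //.
move=> d c M d2 c0 M0 disp T P F y h H grad game H01 eta eta01 omd.
move=> tau stop ystar Pystar.
exact: (expected_regret d2 c0 M0 game H01 eta01 omd stop Pystar).
Qed.
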